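(* Let $\tau>0$. Then $\Lambda^+$ is contained in the $p-n$ horizontal lines $\operatorname{Im}s=\operatorname{Im}a_j$ ($n<j\le p$) and satisfies $\operatorname{Re}s\ge\lambda_\flat$ with $\operatorname{Re}s\to+\infty$; and $\Lambda^-$ is contained in the $q-m$ horizontal lines $\operatorname{Im}s=\operatorname{Im}b_j$ ($m<j\le q$) and satisfies $\operatorname{Re}s\le\lambda_\sharp$ with $\operatorname{Re}s\to-\infty$. (Here ''$\operatorname{Re}s\to\pm\infty$'' means as $s\to\infty$ within the set.)
   Context: $0\le m\le q$ and $0\le n\le p$ are integers, $(a_1,\dots,a_p)\in\mathbb{C}^p$, $(b_1,\dots,b_q)\in\mathbb{C}^q$. $\Lambda^+=\{a_j+l\tau+k:\ n<j\le p,\ l,k\in\mathbb{Z},\ l,k\ge0\}$, $\Lambda^-=\{b_j-l\tau-k:\ m<j\le q,\ l,k\in\mathbb{Z},\ l,k\ge1\}$, $\lambda_\sharp=\max_{m<j\le q}\operatorname{Re}b_j-\tau-1$ ($=-\infty$ if $m=q$), $\lambda_\flat=\min_{n<j\le p}\operatorname{Re}a_j$ ($=+\infty$ if $n=p$). *)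

(* Defs.v *)
From mathcomp Require Import all_boot all_order all_algebra.
From mathcomp Require Import all_classical all_reals all_analysis.
From mathcomp Require Export complex.

Set Implicit Arguments.
Unset Strict Implicit.
Unset Printing Implicit Defensive.

Import Order.TTheory GRing.Theory Num.Theory.
Import numFieldNormedType.Exports.

Local Open Scope classical_set_scope.
Local Open Scope complex_scope.
Local Open Scope ring_scope.

(* The 1-based indices n < j <= p become the 0-based j : 'I_p with n <= j. *)

Definition Lambda_plus (R : realType) (n p : nat) (a : 'I_p -> R[i]) (tau : R)
    : set R[i] :=
  [set s | exists (j : 'I_p) (l k : nat),
     (n <= j)%N /\ s = a j + l%:R * tau%:C + k%:R].

Definition Lambda_minus (R : realType) (m q : nat) (b : 'I_q -> R[i]) (tau : R)
    : set R[i] :=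
  [set s | exists (j : 'I_q) (l k : nat),
     [/\ (m <= j)%N, (1 <= l)%N, (1 <= k)%N
       & s = b j - l%:R * tau%:C - k%:R]].

(* An empty max is -oo, and -oo absorbs the subtracted reals. *)
Definition lambda_sharp (R : realType) (m q : nat) (b : 'I_q -> R[i]) (tau : R)
    : \bar R :=
  (\big[Order.max/-oo]_(j < q | (m <= j)%N) (complex.Re (b j))%:E
     - tau%:E - 1)%E.

Definition lambda_flat (R : realType) (n p : nat) (a : 'I_p -> R[i]) : \bar R :=
  (\big[Order.min/+oo]_(j < p | (n <= j)%N) (complex.Re (a j))%:E)%E.

Definition horizontal_line (R : realType) (y : R) : set R[i] :=
  [set s | complex.Im s = y].

(* The filter of neighbourhoods of the point at infinity of the complex plane;
   the order on R[i] compares M%:C with the (real) norm `|s|. *)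
Definition cinfty (R : realType) : set_system R[i] :=
  filter_from setT (fun M : R => [set s | M%:C < `|s|]).

Instance cinfty_filter (R : realType) : Filter (@cinfty R).
Proof.
apply: filter_from_filter; first by exists 0.
move=> M N _ _; exists (Num.max M N) => // s /= Ms.
by split; apply: le_lt_trans Ms; rewrite lecR le_max lexx ?orbT.
Qed.

(* Main.v *)
Require Import Defs.
From mathcomp Require Import all_boot all_order all_algebra.
From mathcomp Require Import all_classical all_reals all_analysis.
From mathcomp Require Import complex.
From mathcomp Require Import lra.

(** Every element of either set has the form [z + x] with [z] one of finitely
    many complex numbers and [x] real: [x = l tau + k >= 0] for [Lambda_plus],
    and [x = - l tau - k <= - tau - 1] for [Lambda_minus]. Adding [x] does not
    change the imaginary part, which places the sets on the stated horizontal
    lines, and it changes the real part by at least [0], resp. by at most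
    [- tau - 1], which gives the bounds [lambda_flat] and [lambda_sharp]
    ([Lambda_plusP] and [Lambda_minusP]). The limits use no more than this:
    since [`|s| <= `|Re s| + `|Im s|] and [Im s] is bounded on each set,
    [`|Re s|] is large as soon as [`|s|] is, and the one-sided bound on [Re s]
    determines its sign ([cvg_Re_pinfty] and [cvg_Re_ninfty]). *)

Import Order.TTheory GRing.Theory Num.Theory.
Import numFieldNormedType.Exports.

Local Open Scope classical_set_scope.
Local Open Scope complex_scope.
Local Open Scope ring_scope.

Lemma normc_le_ReIm (R : rcfType) (z : R[i]) :
  `|z| <= (`|complex.Re z| + `|complex.Im z|)%:C.
Proof.
rewrite normc_def lecR -[leRHS]ger0_norm ?addr_ge0//.
rewrite -[leRHS]sqrtr_sqr ler_wsqrtr//.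
rewrite sqrrD !real_normK ?num_real// -addrA lerD2l lerDr.
by rewrite mulrn_wge0 ?mulr_ge0.
Qed.

Lemma Re_addC (R : rcfType) (z : R[i]) (x : R) :
  complex.Re (z + x%:C) = complex.Re z + x.
Proof. by case: z. Qed.

Lemma Im_addC (R : rcfType) (z : R[i]) (x : R) :
  complex.Im (z + x%:C) = complex.Im z.
Proof. by case: z => u v /=; rewrite addr0. Qed.

Section ReInfinity.
Variables (R : realType) (S : set R[i]) (B : R).
Hypothesis ImB : forall s, S s -> `|complex.Im s| <= B.

(** On a set contained in a horizontal strip, only the real part can account
    for a large modulus. *)
Lemma near_cinfty_Re_gt (A : R) :
  \forall s \near within S (@cinfty R), A < `|complex.Re s|.
Proof.
rewrite near_withinE; exists (A + B) => // s /= ABs Ss.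
have := lt_le_trans ABs (normc_le_ReIm _ s).
by rewrite ltcR; have := ImB _ Ss; lra.
Qed.

Lemma cvg_Re_pinfty (c : R) : (forall s, S s -> c <= complex.Re s) ->
  complex.Re s @[s --> within S (@cinfty R)] --> +oo.
Proof.
move=> cRe; apply/cvgryPgt => A.
have SS : \forall s \near within S (@cinfty R), S s.
  by rewrite near_withinE; apply: nearW.
(* [- c < `|Re s|] and [c <= Re s] exclude [Re s < 0]. *)
apply: filterS3 SS (near_cinfty_Re_gt A) (near_cinfty_Re_gt (- c)).
by move=> s /cRe; case: ger0P; lra.
Qed.

Lemma cvg_Re_ninfty (c : R) : (forall s, S s -> complex.Re s <= c) ->
  complex.Re s @[s --> within S (@cinfty R)] --> -oo.
Proof.
move=> Rec; apply/cvgrNyPlt => A.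
have SS : \forall s \near within S (@cinfty R), S s.
  by rewrite near_withinE; apply: nearW.
(* [c < `|Re s|] and [Re s <= c] exclude [0 <= Re s]. *)
apply: filterS3 SS (near_cinfty_Re_gt (- A)) (near_cinfty_Re_gt c).
by move=> s /Rec; case: ger0P; lra.
Qed.

End ReInfinity.

Lemma Lambda_plusP (R : realType) (n p : nat) (a : 'I_p -> R[i]) (tau : R)
    (s : R[i]) : 0 < tau -> Lambda_plus n a tau s ->
  exists j : 'I_p, [/\ (n <= j)%N, complex.Im s = complex.Im (a j)
    & complex.Re (a j) <= complex.Re s].
Proof.
move=> tau0 [j [l [k [nj ->]]]]; exists j.
have -> : a j + l%:R * tau%:C + k%:R = a j + (l%:R * tau + k%:R)%:C.
  by rewrite rmorphD rmorphM !rmorph_nat addrA.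
rewrite Re_addC Im_addC lerDl; split=> //.
by rewrite addr_ge0 ?mulr_ge0// ltW.
Qed.

Lemma Lambda_minusP (R : realType) (m q : nat) (b : 'I_q -> R[i]) (tau : R)
    (s : R[i]) : 0 < tau -> Lambda_minus m b tau s ->
  exists j : 'I_q, [/\ (m <= j)%N, complex.Im s = complex.Im (b j)
    & complex.Re s <= complex.Re (b j) - tau - 1].
Proof.
move=> tau0 [j [l [k [mj l1 k1 ->]]]]; exists j.
have -> : b j - l%:R * tau%:C - k%:R = b j + (- (l%:R * tau) - k%:R)%:C.
  by rewrite rmorphB rmorphN rmorphM !rmorph_nat addrA.
rewrite Re_addC Im_addC -addrA lerD2l; split=> //.
rewrite lerB ?ler1n// lerN2 ler_peMl ?ler1n//; exact: ltW.
Qed.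

Theorem proposition3p1 (R : realType) (m n p q : nat)
    (hmq : (m <= q)%N) (hnp : (n <= p)%N)
    (a : 'I_p -> R[i]) (b : 'I_q -> R[i]) (tau : R) (htau : 0 < tau) :
  [/\ Lambda_plus n a tau `<=`
        \bigcup_(j in [set j : 'I_p | (n <= j)%N])
          horizontal_line (complex.Im (a j)),
      forall s, Lambda_plus n a tau s ->
        (lambda_flat n a <= (complex.Re s)%:E)%E
    & complex.Re s @[s --> within (Lambda_plus n a tau) (@cinfty R)] --> +oo]
  /\
  [/\ Lambda_minus m b tau `<=`
        \bigcup_(j in [set j : 'I_q | (m <= j)%N])
          horizontal_line (complex.Im (b j)),
      forall s, Lambda_minus m b tau s ->
        ((complex.Re s)%:E <= lambda_sharp m b tau)%E
    & complex.Re s @[s --> within (Lambda_minus m b tau) (@cinfty R)] --> -oo].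
Proof.
split; split.
- move=> s /(Lambda_plusP _ _ _ _ _ _ htau)[j [nj Ims _]]; by exists j.
- move=> s /(Lambda_plusP _ _ _ _ _ _ htau)[j [nj _ Res]].
  apply: (@le_trans _ _ (complex.Re (a j))%:E); last by rewrite lee_fin.
  exact: (bigmin_le_cond _ (fun i => (complex.Re (a i))%:E)).
- (* The default value 0 in the extrema over all [j] below is harmless: any
     real bound will do. *)
  apply: (@cvg_Re_pinfty _ _ (\big[Order.max/0]_j `|complex.Im (a j)|) _
    (\big[Order.min/0]_j complex.Re (a j))) =>
    s /(Lambda_plusP _ _ _ _ _ _ htau)[j [_ Ims Res]].
    by rewrite Ims (le_bigmax _ (fun i => `|complex.Im (a i)|)).
  by apply: le_trans Res; exact: (bigmin_le _ _ (fun i => complex.Re (a i))).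
- move=> s /(Lambda_minusP _ _ _ _ _ _ htau)[j [mj Ims _]]; by exists j.
- move=> s /(Lambda_minusP _ _ _ _ _ _ htau)[j [mj _ Res]].
  apply: (@le_trans _ _ ((complex.Re (b j))%:E - tau%:E - 1)%E).
    by rewrite -!EFinB lee_fin.
  rewrite /lambda_sharp leeB// leeB//.
  exact: (le_bigmax_cond _ (fun i => (complex.Re (b i))%:E)).
- apply: (@cvg_Re_ninfty _ _ (\big[Order.max/0]_j `|complex.Im (b j)|) _
    (\big[Order.max/0]_j complex.Re (b j) - tau - 1)) =>
    s /(Lambda_minusP _ _ _ _ _ _ htau)[j [_ Ims Res]].
    by rewrite Ims (le_bigmax _ (fun i => `|complex.Im (b i)|)).
  apply: le_trans Res _; rewrite !lerD2r.
  exact: (le_bigmax _ (fun i => complex.Re (b i))).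
Qed.
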